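(* Let $H=\langle x_1,\ldots,x_n\mid R\rangle$ be a left orderable finitely generated group given by a reduced presentation. Then the formal square root $G$ of $H$ (with respect to this presentation) is left orderable.
   Context: A group is left orderable if it admits a left-invariant total order. For a group presentation $H=\langle x_1,\ldots,x_n\mid R\rangle$, the formal square root of $H$ is the group $G=\langle y_1,\ldots,y_n,x_1,\ldots,x_n\mid R,\ x_1=y_1^2,\ldots,x_n=y_n^2\rangle$; it depends on the given presentation. The presentation of $H$ is called reduced if $x_i$ is nontrivial in $H$ for each $i$. *)

(* Defs.v *)
From HB Require Import structures.
From mathcomp Require Import all_boot.
From mathcomp Require Import boolp.

Set Implicit Arguments.
Unset Strict Implicit.
Unset Printing Implicit Defensive.

Local Open Scope group_scope.
Local Open Scope quotient_scope.

Definition left_orderable (G : groupType) : Prop :=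
  exists le : rel G,
    [/\ reflexive le, antisymmetric le, transitive le, total le
      & forall g x y : G, le x y -> le (g * x) (g * y)].

(* Words in the letters x (encoded as (x, true)) and x^-1 (as (x, false)),
   not necessarily freely reduced; words are multiplied by concatenation. *)
Definition word (X : Type) := seq (X * bool).

Definition word_inv (X : Type) (w : word X) : word X :=
  rev [seq (a.1, ~~ a.2) | a <- w].

(* A set of defining relations u = v; a relator r is the relation r = 1, that
   is, the pair of r and the empty word. No finiteness is imposed. *)
Definition relations (X : Type) := word X -> word X -> Prop.

(* Equality of words in < X | R >. *)
Inductive pres_eq (X : Type) (R : relations X) : word X -> word X -> Prop :=
| pres_eq_refl u : pres_eq R u u
| pres_eq_sym u v : pres_eq R u v -> pres_eq R v u
| pres_eq_trans u v w : pres_eq R u v -> pres_eq R v w -> pres_eq R u w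
| pres_eq_cancel p q x b : pres_eq R (p ++ [:: (x, b); (x, ~~ b)] ++ q) (p ++ q)
| pres_eq_rel p q u v : R u v -> pres_eq R (p ++ u ++ q) (p ++ v ++ q).

Section PresentedGroup.

Variables (X : choiceType) (R : relations X).

Implicit Types u v w p q : word X.

Definition pres_eqb : rel (word X) := fun u v => `[< pres_eq R u v >].

Lemma pres_eqbP u v : reflect (pres_eq R u v) (pres_eqb u v).
Proof. exact: asboolP. Qed.

Fact pres_eqb_refl : reflexive pres_eqb.
Proof. by move=> u; apply/pres_eqbP/pres_eq_refl. Qed.

Fact pres_eqb_sym : symmetric pres_eqb.
Proof. by move=> u v; apply/pres_eqbP/pres_eqbP; apply: pres_eq_sym. Qed.

Fact pres_eqb_trans : transitive pres_eqb.
Proof.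
by move=> v u w /pres_eqbP uv /pres_eqbP vw; apply/pres_eqbP/pres_eq_trans/vw.
Qed.

Canonical pres_equiv :=
  EquivRel pres_eqb pres_eqb_refl pres_eqb_sym pres_eqb_trans.

(* The group < X | R >. *)
Definition presented := {eq_quot pres_equiv}.

HB.instance Definition _ := EqQuotient.on presented.
HB.instance Definition _ := Choice.on presented.

Lemma pi_presented u v :
  \pi_presented u = \pi_presented v <-> pres_eq R u v.
Proof.
split=> [/eqP|uv]; first by rewrite eqmodE => /pres_eqbP.
by apply/eqP; rewrite eqmodE; apply/pres_eqbP.
Qed.

Lemma pres_eq_cat2 p q u v :
  pres_eq R u v -> pres_eq R (p ++ u ++ q) (p ++ v ++ q).
Proof.
elim=> {u v} [u|u v _|u v w _ IHu _|p' q' x b|p' q' u v Ruv].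
- exact: pres_eq_refl.
- exact: pres_eq_sym.
- exact: pres_eq_trans.
- by have := pres_eq_cancel R (p ++ p') (q' ++ q) x b; rewrite -!catA.
- by have := pres_eq_rel (p ++ p') (q' ++ q) Ruv; rewrite -!catA.
Qed.

Lemma pres_eq_cat u v u' v' :
  pres_eq R u u' -> pres_eq R v v' -> pres_eq R (u ++ v) (u' ++ v').
Proof.
move=> uu' vv'; apply: (@pres_eq_trans _ _ _ (u' ++ v)).
  exact: (@pres_eq_cat2 [::] v).
by have := pres_eq_cat2 u' [::] vv'; rewrite !cats0.
Qed.

Lemma word_inv_cat u v : word_inv (u ++ v) = word_inv v ++ word_inv u.
Proof. by rewrite /word_inv map_cat rev_cat. Qed.

Lemma word_invK : involutive (@word_inv X).
Proof.
move=> u; rewrite /word_inv map_rev revK -map_comp map_id_in // => -[x b] _ /=.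
by rewrite negbK.
Qed.

Lemma pres_eq_catVw u : pres_eq R (word_inv u ++ u) [::].
Proof.
elim: u => [|[x b] u IHu]; first exact: pres_eq_refl.
apply: pres_eq_trans IHu.
have := pres_eq_cancel R (word_inv u) u x (~~ b).
by rewrite negbK -[_ :: u]cat1s word_inv_cat -!catA.
Qed.

Lemma pres_eq_catwV u : pres_eq R (u ++ word_inv u) [::].
Proof. by rewrite -{1}[u]word_invK; apply: pres_eq_catVw. Qed.

Lemma pres_eq_inv u v : pres_eq R u v -> pres_eq R (word_inv u) (word_inv v).
Proof.
move=> uv; apply: (@pres_eq_trans _ _ _ (word_inv u ++ v ++ word_inv v)).
  rewrite -{1}[word_inv u]cats0; apply: pres_eq_cat; first exact: pres_eq_refl.
  exact/pres_eq_sym/pres_eq_catwV.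
rewrite catA -[X in pres_eq R _ X]cat0s.
apply: pres_eq_cat; last exact: pres_eq_refl.
apply: pres_eq_trans (pres_eq_catVw u); apply: pres_eq_cat.
  exact: pres_eq_refl.
exact: pres_eq_sym.
Qed.

Definition pres_one : presented := \pi_presented [::].
Definition pres_mul (a b : presented) : presented :=
  \pi_presented (repr a ++ repr b).
Definition pres_inv (a : presented) : presented :=
  \pi_presented (word_inv (repr a)).

Lemma pres_eq_repr u : pres_eq R (repr (\pi_presented u)) u.
Proof. by apply/pi_presented; rewrite reprK. Qed.

Lemma pi_cat u v :
  \pi_presented (u ++ v) = pres_mul (\pi_presented u) (\pi_presented v).
Proof.
by apply/pi_presented/pres_eq_sym/pres_eq_cat; apply: pres_eq_repr.
Qed.

Lemma pi_inv u : \pi_presented (word_inv u) = pres_inv (\pi_presented u).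
Proof. exact/pi_presented/pres_eq_sym/pres_eq_inv/pres_eq_repr. Qed.

Fact pres_mulA : associative pres_mul.
Proof.
elim/quotW=> u; elim/quotW=> v; elim/quotW=> w.
rewrite -(pi_cat v w) -(pi_cat u v).
by rewrite -(pi_cat u (v ++ w)) -(pi_cat (u ++ v) w) catA.
Qed.

Fact pres_mul1 : left_id pres_one pres_mul.
Proof. by elim/quotW=> u; rewrite -(pi_cat [::] u). Qed.

Fact pres_mulr1 : right_id pres_one pres_mul.
Proof. by elim/quotW=> u; rewrite -(pi_cat u [::]) cats0. Qed.

Fact pres_mulV : left_inverse pres_one pres_inv pres_mul.
Proof.
elim/quotW=> u; rewrite -(pi_inv u) -(pi_cat (word_inv u) u).
exact/pi_presented/pres_eq_catVw.
Qed.

Fact pres_mulrV : right_inverse pres_one pres_inv pres_mul.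
Proof.
elim/quotW=> u; rewrite -(pi_inv u) -(pi_cat u (word_inv u)).
exact/pi_presented/pres_eq_catwV.
Qed.

HB.instance Definition _ := isGroup.Build presented
  pres_mulA pres_mul1 pres_mulr1 pres_mulV pres_mulrV.

Definition gen (x : X) : presented := \pi_presented [:: (x, true)].

Definition reduced_presentation : Prop := forall x : X, gen x <> 1.

End PresentedGroup.

(* The generators of the formal square root: y_i is inl i and x_i is inr i. *)
Inductive sqrt_relations (X : Type) (R : relations X) : relations (X + X) :=
| sqrt_base u v : R u v ->
    sqrt_relations R [seq (inr a.1, a.2) | a <- u] [seq (inr a.1, a.2) | a <- v]
| sqrt_square x :
    sqrt_relations R [:: (inr x, true)] [:: (inl x, true); (inl x, true)].

Definition formal_sqrt (X : choiceType) (R : relations X) : groupType :=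
  presented (sqrt_relations R).

(* Main.v *)
Require Import Defs.
From HB Require Import structures.
From mathcomp Require Import all_boot all_order all_algebra.
From mathcomp Require Import boolp.

(* Let H act on the countable dense order T = H x Q (lexicographic) by left
   translation on the first factor. Every x_i acts without fixed points, hence
   has square roots among the order automorphisms of T, and each choice of roots
   makes the formal square root G act on T. An element of G outside H is a
   product h_m y_{i_m} ... h_1 y_{i_1} h_0 in which h_j is not a power of x_i
   whenever i_j = i_{j+1} = i; following the trajectory of a point, the values of
   the roots can be chosen one at a time, each in a new H-orbit, so that the
   product moves the point. Comparing the images of that point lexicographically
   over the countably many actions so obtained orders G. *)

Set Implicit Arguments.
Unset Strict Implicit.
Unset Printing Implicit Defensive.

Import Order.TTheory Num.Theory.

Local Open Scope order_scope.
Local Open Scope group_scope.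
Local Open Scope quotient_scope.

(** * Partial square roots of an increasing map that moves every point up *)

Section RootGerm.

Variables (d : Order.disp_t) (T : orderType d) (f g : T -> T).
Hypotheses (fK : cancel f g) (gK : cancel g f).
Hypotheses (f_lt : {mono f : a b / a < b}) (f_gt : forall a, a < f a).

Implicit Types (a b c : T) (p q : T * T) (Y : T * T -> Prop).

(* If [y] is a square root of [f] and [y a = b], then [y b = f a]. *)
Definition shift p := (p.2, f p.1).
Definition unshift p := (g p.2, p.1).

Lemma shiftK : cancel shift unshift.
Proof. by case=> a b; rewrite /unshift /= fK. Qed.

Lemma unshiftK : cancel unshift shift.
Proof. by case=> a b; rewrite /shift /= gK. Qed.

(** The disjunction stands for integer powers of [shift]; a root through [p] passes through this
    whole orbit. *)
Definition shift_orbit p q := exists k, q = iter k shift p \/ p = iter k shift q.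

(* A partial square root of [f], given by its graph; the last clause says that
   only finitely many of its points lie near a given point. *)
Record root_germ Y : Prop := RootGerm {
  germ_shift : forall p, Y p <-> Y (shift p);
  germ_lt : forall p q, Y p -> Y q -> p.1 < q.1 -> p.2 < q.2;
  germ_gt : forall p, Y p -> p.1 < p.2;
  germ_fin : forall a, exists L : seq (T * T),
    forall p, Y p -> [\/ p \in L, f p.1 < a | f a < p.1] }.

Lemma shift_orbit_refl p : shift_orbit p p.
Proof. by exists 0%N; left. Qed.

Lemma shift_orbit_sym p q : shift_orbit p q -> shift_orbit q p.
Proof. by case=> k [] E; exists k; [right|left]. Qed.

Lemma iter_shift_inj k : injective (iter k shift).
Proof. by elim: k => [|k IH] p q //= /(can_inj shiftK)/IH. Qed.

Lemma shift_orbit_trans p q r :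
  shift_orbit p q -> shift_orbit q r -> shift_orbit p r.
Proof.
case=> k [] Ek [l [] El].
- by exists (l + k)%N; left; rewrite iterD -Ek.
- case: (leqP k l) => kl.
    by exists (l - k)%N; right; apply/(@iter_shift_inj k);
    by rewrite -iterD subnKC ?El // -Ek.
  exists (k - l)%N; left; apply/(@iter_shift_inj l).
  by rewrite -iterD subnKC ?(ltnW kl) // -Ek.
- case: (leqP k l) => kl.
    by exists (l - k)%N; left; rewrite El Ek -iterD subnK.
  by exists (k - l)%N; right; rewrite Ek El -iterD subnK // ltnW.
- by exists (k + l)%N; right; rewrite iterD -El.
Qed.

Lemma shift_orbit1 p : shift_orbit p (shift p).
Proof. by exists 1%N; left. Qed.

Lemma shift_orbit_ind (P : T * T -> Prop) p q :
  (forall r, P r <-> P (shift r)) -> P p -> shift_orbit p q -> P q.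
Proof.
move=> PE Pp [k [] E]; first by rewrite E; elim: (k) => //= m Pm; apply: (PE _).1.
by move: Pp; rewrite E; elim: (k) => //= m IH Pm; apply/IH/PE.
Qed.

Definition rising p := p.1 < p.2 < f p.1.

Lemma rising_shift p : rising p <-> rising (shift p).
Proof. by rewrite /rising /= f_lt andbC; split. Qed.

Lemma rising_iter p k : rising p -> rising (iter k shift p).
Proof. by move=> rp; apply: (shift_orbit_ind rising_shift rp); exists k; left. Qed.

Lemma rising_lt p k : rising p -> p.1 < (iter k.+1 shift p).1.
Proof.
move=> rp; elim: k => [|k IH]; first by case/andP: rp.
by apply: (lt_trans IH); have /andP[] := rising_iter k.+1 rp.
Qed.

(** The orbit of [(a, b)] runs along the increasing chain a < b < f a < f b < ... *)
Lemma rising_orbit_lt p q :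
  rising p -> shift_orbit p q -> p.1 < q.1 -> p.2 < q.2.
Proof.
move=> rp opq; have rq := shift_orbit_ind rising_shift rp opq.
case: opq => -[|k] [->|E]; rewrite ?E ?ltxx //.
  move=> _; have /(rising_lt k) := (rising_shift p).1 rp.
  by rewrite -iterSr iterS.
by have := rising_lt k rq; rewrite -E => /lt_trans h /h; rewrite ltxx.
Qed.

(** Two shifts apply [f] to the first coordinate, so four reach [f (f p.1)], which is at least
    [f a]; the fifth makes the inequality strict. *)
Lemma rising_far p k a :
  rising p -> a <= f p.1 -> (5 <= k)%N -> f a < (iter k shift p).1.
Proof.
move=> rp ap; case: k => // k k4.
have r4 := rising_iter 4 rp.
apply: (@le_lt_trans _ _ (iter 4 shift p).1); first by rewrite /= leNgt f_lt -leNgt.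
by rewrite -(subnK k4) addnS -addSn iterD; apply: rising_lt.
Qed.

Lemma rising_orbit_fin p a : rising p ->
  exists L : seq (T * T),
    forall q, shift_orbit p q -> [\/ q \in L, f q.1 < a | f a < q.1].
Proof.
move=> rp.
(* If the orbit has a point [r] in the window around [a], all points five or more shifts away from
   [r] lie outside the window. *)
have [[r [opr ar ra]]|none] :=
  pselect (exists r, [/\ shift_orbit p r, a <= f r.1 & r.1 <= f a]); last first.
  exists [::] => q opq; case: (ltP (f q.1) a) => [|aq]; first by constructor 2.
  case: (ltP (f a) q.1) => [|qa]; first by constructor 3.
  by case: none; exists q.
have rr := shift_orbit_ind rising_shift rp opr.
exists ([seq iter k shift r | k <- iota 0 5] ++
        [seq iter k unshift r | k <- iota 0 5]) => q opq.
have rq := shift_orbit_ind rising_shift rp opq.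
have [k [] E] := shift_orbit_trans (shift_orbit_sym opr) opq.
  case: (leqP 5 k) => k5; first by constructor 3; rewrite E; apply: rising_far.
  constructor 1; rewrite mem_cat; apply/orP; left; apply/mapP; exists k => //.
  by rewrite mem_iota.
case: (leqP 5 k) => k5.
  case: (ltP (f q.1) a) => [|aq]; first by constructor 2.
  by have := rising_far rq aq k5; rewrite -E ltNge ra.
constructor 1; rewrite mem_cat; apply/orP; right; apply/mapP; exists k.
  by rewrite mem_iota.
by rewrite E; elim: (k) (q) => // m IH s; rewrite iterSr iterS shiftK -IH.
Qed.

Lemma germ_rising Y p : root_germ Y -> Y p -> rising p.
Proof.
move=> gY Yp; rewrite /rising (germ_gt gY Yp) /=.
by have /(germ_gt gY) := (germ_shift gY p).1 Yp.
Qed.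

Lemma seq_max a (s : seq T) :
  exists2 m, m \in a :: s & forall z, z \in a :: s -> z <= m.
Proof.
elim: s a => [|b s IH] a.
  by exists a => [|z]; rewrite inE ?eqxx // => /eqP->.
have [m ms le_m] := IH b.
case: (leP a m) => am.
  exists m => [|z]; first by rewrite inE ms orbT.
  by rewrite inE => /predU1P[->|/le_m].
exists a => [|z]; first by rewrite inE eqxx.
by rewrite inE => /predU1P[-> //|/le_m zm]; apply: le_trans zm (ltW am).
Qed.

Lemma seq_min a (s : seq T) :
  exists2 m, m \in a :: s & forall z, z \in a :: s -> m <= z.
Proof.
elim: s a => [|b s IH] a.
  by exists a => [|z]; rewrite inE ?eqxx // => /eqP->.
have [m ms le_m] := IH b.
case: (leP m a) => am.
  exists m => [|z]; first by rewrite inE ms orbT.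
  by rewrite inE => /predU1P[->|/le_m].
exists a => [|z]; first by rewrite inE eqxx.
by rewrite inE => /predU1P[-> //|/le_m]; apply: le_trans (ltW am).
Qed.

Definition germ_adjoin Y p q := Y q \/ shift_orbit p q.

(** Compatibility with [Y] is invariant under [shift], since [Y] is, so testing [p] alone settles
    its whole orbit. *)
Lemma germ_adjoinP Y p : root_germ Y -> rising p ->
  (forall q, Y q -> (q.1 < p.1) && (q.2 < p.2) || (p.1 < q.1) && (p.2 < q.2)) ->
  root_germ (germ_adjoin Y p).
Proof.
move=> gY rp cmp_p.
have cmp q o : Y q -> shift_orbit p o ->
    (q.1 < o.1) && (q.2 < o.2) || (o.1 < q.1) && (o.2 < q.2).
  move=> Yq opo; move: q Yq.
  apply: (shift_orbit_ind (P := fun o => forall q, Y q -> (q.1 < o.1) && (q.2 < o.2)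
     || (o.1 < q.1) && (o.2 < q.2)) _ cmp_p opo) => {opo}o.
  split=> cmp_o q Yq.
    have /cmp_o : Y (unshift q) by apply/(germ_shift gY); rewrite unshiftK.
    by rewrite /= -(f_lt _ o.1) -(f_lt o.1) !gK andbC [X in _ || X]andbC.
  have := cmp_o _ ((germ_shift gY q).1 Yq).
  by rewrite /= !f_lt andbC [X in _ || X]andbC.
split.
- move=> q; split=> -[Yq|oq].
  + by left; apply: (germ_shift gY q).1.
  + by right; apply: shift_orbit_trans oq (shift_orbit1 q).
  + by left; apply: (germ_shift gY q).2.
  + by right; apply: shift_orbit_trans oq (shift_orbit_sym (shift_orbit1 q)).
- move=> q r [Yq|oq] [Yr|pr].
  + exact: (germ_lt gY).
  + by case/orP: (cmp _ _ Yq pr) => /andP[] // /lt_trans h _ /h; rewrite ltxx.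
  + by case/orP: (cmp _ _ Yr oq) => /andP[] // /lt_trans h _ /h; rewrite ltxx.
  + apply: rising_orbit_lt; first exact: shift_orbit_ind rising_shift rp oq.
    exact: shift_orbit_trans (shift_orbit_sym oq) pr.
- move=> q [/(germ_gt gY) //|oq].
  by case/andP: (shift_orbit_ind rising_shift rp oq).
- move=> a; have [L LP] := germ_fin gY a; have [M MP] := rising_orbit_fin a rp.
  exists (L ++ M) => q [/LP|/MP] []; rewrite ?mem_cat.
  + by constructor 1; rewrite p0.
  + by constructor 2.
  + by constructor 3.
  + by constructor 1; rewrite p0 orbT.
  + by constructor 2.
  + by constructor 3.
Qed.

(* By local finiteness the constraints on the image of a new point [a] amount to
   finitely many inequalities. *)
Lemma germ_extend Y a : root_germ Y -> (forall b, ~ Y (a, b)) ->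
  exists u v, u < v /\ forall b, u < b < v -> root_germ (germ_adjoin Y (a, b)).
Proof.
move=> gY aY; have [L LP] := germ_fin gY a.
pose A := [seq p.2 | p <- L & `[< Y p >] && (p.1 < a)].
pose B := [seq p.2 | p <- L & `[< Y p >] && (a < p.1)].
have AP z : z \in a :: A -> z = a \/ exists p, [/\ Y p, p.1 < a & z = p.2].
  rewrite inE => /predU1P[->|/mapP[p]]; first by left.
  by rewrite mem_filter => /andP[/andP[/asboolP Yp pa] _] ->; right; exists p.
have BP z : z \in f a :: B -> z = f a \/ exists p, [/\ Y p, a < p.1 & z = p.2].
  rewrite inE => /predU1P[->|/mapP[p]]; first by left.
  by rewrite mem_filter => /andP[/andP[/asboolP Yp pa] _] ->; right; exists p.
(* The listed germ points left of [a] bound the image from below and those right of [a] from above;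
   [a] and [f a] give the rising condition. Unlisted points are a full application of [f] away from
   [a] and comply automatically. *)
have [u uA uP] := seq_max a A; have [v vB vP] := seq_min (f a) B.
have lt_f p : Y p -> p.2 < f p.1 by move=> Yp; have /andP[] := germ_rising gY Yp.
have gt_f p : Y p -> p.1 < p.2 by move=> Yp; have /andP[] := germ_rising gY Yp.
exists u, v; split.
  case: (AP _ uA) (BP _ vB) => [->|[p [Yp pa ->]]] [->|[q [Yq aq ->]]].
  - exact: f_gt.
  - exact: lt_trans aq (gt_f _ Yq).
  - by apply: lt_trans (lt_f _ Yp) _; rewrite f_lt.
  - exact: (germ_lt gY Yp Yq (lt_trans pa aq)).
move=> b /andP[ub bv].
have ab : a < b by apply: le_lt_trans ub; apply: uP; rewrite inE eqxx.
have ba : b < f a by apply: lt_le_trans bv _; apply: vP; rewrite inE eqxx.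
apply: germ_adjoinP => // [|p Yp /=]; first by rewrite /rising ab.
case: (ltgtP p.1 a) => [pa|ap|E] /=;
  last by case: (aY p.2); rewrite -E -surjective_pairing.
  rewrite orbF; case: (LP _ Yp) => [pL|pfa|fap].
  - apply: le_lt_trans ub; apply: uP; rewrite inE; apply/orP; right.
    by apply: map_f; rewrite mem_filter pL pa !andbT; apply/asboolP.
  - by apply: lt_trans (lt_f _ Yp) (lt_trans pfa ab).
  - by have := lt_trans (lt_trans pa (f_gt a)) fap; rewrite ltxx.
case: (LP _ Yp) => [pL|pfa|fap].
- apply: lt_le_trans bv _; apply: vP; rewrite inE; apply/orP; right.
  by apply: map_f; rewrite mem_filter pL ap !andbT; apply/asboolP.
- by have := lt_trans (lt_trans ap (f_gt p.1)) pfa; rewrite ltxx.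
- by apply: lt_trans ba (lt_trans fap (gt_f _ Yp)).
Qed.

Hypothesis T_dense : forall a b, a < b -> exists c, a < c < b.

Lemma germ_total_step Y a : root_germ Y ->
  exists Y', [/\ root_germ Y', forall p, Y p -> Y' p & exists b, Y' (a, b)].
Proof.
move=> gY; have [Ya|Ya] := pselect (exists b, Y (a, b)); first by exists Y.
have aY b : ~ Y (a, b) by move=> Yb; apply: Ya; exists b.
have [u [v [/T_dense[b ubv] gb]]] := germ_extend gY aY.
exists (germ_adjoin Y (a, b)); split; [exact: gb|by left|].
by exists b; right; apply: shift_orbit_refl.
Qed.

(** Distinct values would, by monotonicity at the shifted points, give distinct images under [f] of
    the same point. *)
Lemma germ_fun Y p q : root_germ Y -> Y p -> Y q -> p.1 = q.1 -> p.2 = q.2.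
Proof.
move=> gY Yp Yq E; have Yp' := (germ_shift gY p).1 Yp.
have Yq' := (germ_shift gY q).1 Yq.
case: (ltgtP p.2 q.2) => // [/(germ_lt gY Yp' Yq')|/(germ_lt gY Yq' Yp')];
  by rewrite /= E ltxx.
Qed.

(** The enumeration [e] is run through, making the germ defined at one more point at each stage; the
    union of the chain is the graph of [y]. *)
Lemma germ_total Y (e : nat -> T) :
  (forall a, exists m, e m = a) -> root_germ Y ->
  exists y : T -> T, [/\ forall a, y (y a) = f a, {homo y : a b / a < b},
    forall a, a < y a < f a & forall p, Y p -> y p.1 = p.2].
Proof.
move=> e_onto gY.
have [next nextP] : exists next : nat -> {Y | root_germ Y} -> {Y | root_germ Y},
    forall m Z, (forall p, sval Z p -> sval (next m Z) p) /\
      exists b, sval (next m Z) (e m, b).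
  have /choice[next nextP] : forall mZ : nat * {Y | root_germ Y},
      exists Z' : {Y | root_germ Y}, (forall p, sval mZ.2 p -> sval Z' p) /\
      exists b, sval Z' (e mZ.1, b).
    case=> m [Z gZ] /=; have [Z' [gZ' ZZ' Z'm]] := germ_total_step (e m) gZ.
    by exists (exist _ Z' gZ').
  by exists (fun m Z => next (m, Z)) => m Z; apply: nextP (m, Z).
pose Z m := iteri m next (exist _ Y gY).
have Z_mono m n p : (m <= n)%N -> sval (Z m) p -> sval (Z n) p.
  move=> mn Zp; rewrite -(subnK mn); elim: (n - m)%N => //= k IH.
  by apply: (nextP _ _).1.
have gZ m : root_germ (sval (Z m)) by case: (Z m).
have /choice[y yP] : forall a, exists b m, sval (Z m) (a, b).
  move=> a; have [m <-] := e_onto a.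
  by have [b Zb] := (nextP m (Z m)).2; exists b, m.+1.
have yE m p : sval (Z m) p -> y p.1 = p.2.
  move=> Zp; have [n Zn] := yP p.1.
  apply: (germ_fun (gZ (maxn m n)) _ _ (erefl : (p.1, y p.1).1 = p.1)).
    exact: Z_mono (leq_maxr _ _) Zn.
  exact: Z_mono (leq_maxl _ _) Zp.
exists y; split.
- move=> a; have [m Zm] := yP a.
  exact: (yE m (shift (a, y a)) ((germ_shift (gZ m) _).1 Zm)).
- move=> a b ab; have [m Zm] := yP a; have [n Zn] := yP b.
  apply: (germ_lt (gZ (maxn m n)) (p := (a, y a)) (q := (b, y b))) => //.
    exact: Z_mono (leq_maxl _ _) Zm.
  exact: Z_mono (leq_maxr _ _) Zn.
- by move=> a; have [m Zm] := yP a; apply: (germ_rising (gZ m) Zm).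
- by move=> p Yp; apply: (yE 0%N).
Qed.

End RootGerm.

(** * Generic square roots for a free order-preserving action *)

Section GenericRoots.

Variables (H : groupType) (d : Order.disp_t) (T : orderType d).
Variable act : H -> T -> T.
Hypotheses (act1 : forall a, act 1 a = a).
Hypotheses (actM : forall h k a, act (h * k) a = act h (act k a)).
Hypotheses (act_lt : forall h, {mono act h : a b / a < b}).
Hypotheses (act_free : forall h a, act h a = a -> h = 1).
Hypothesis act_dense : forall (Q : seq T) a b, a < b ->
  exists2 c, a < c < b & forall q h, q \in Q -> c <> act h q.
Variable e : nat -> T.
Hypothesis e_onto : forall a, exists m, e m = a.
Variables (I : eqType) (x : I -> H).
Hypothesis x_neq1 : forall i, x i <> 1.

Implicit Types (i j : I) (h k : H) (a b c : T) (l : seq (I * H)).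

Lemma actK h : cancel (act h) (act h^-1).
Proof. by move=> a; rewrite -actM mulVg act1. Qed.

Lemma actVK h : cancel (act h^-1) (act h).
Proof. by move=> a; rewrite -actM mulgV act1. Qed.

Definition up i a := a < act (x i) a.

Lemma upPn i a : ~~ up i a -> act (x i) a < a.
Proof.
rewrite /up -leNgt le_eqVlt => /predU1P[/act_free/x_neq1 //|//].
Qed.

(** [x i] may move some points up and others down; reversing it on the latter gives a map to which
    the germs apply. *)
Definition raise i a := if up i a then act (x i) a else act (x i)^-1 a.
Definition lower i a := if up i a then act (x i)^-1 a else act (x i) a.

Lemma up_actx i a : up i (act (x i) a) = up i a.
Proof. exact: act_lt. Qed.

Lemma up_actV i a : up i (act (x i)^-1 a) = up i a.
Proof. by rewrite -up_actx actVK. Qed.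

Lemma raiseK i : cancel (raise i) (lower i).
Proof.
move=> a; rewrite /raise; case: ifP => u; rewrite /lower.
  by rewrite up_actx u actK.
by rewrite up_actV u actVK.
Qed.

Lemma lowerK i : cancel (lower i) (raise i).
Proof.
move=> a; rewrite /lower; case: ifP => u; rewrite /raise.
  by rewrite up_actV u actVK.
by rewrite up_actx u actK.
Qed.

Lemma raise_gt i a : a < raise i a.
Proof.
rewrite /raise; case: ifP => // /negbT/upPn.
by rewrite -(act_lt (x i)^-1) actK.
Qed.

Lemma raise_lt i : {mono raise i : a b / a < b}.
Proof.
apply/leW_mono/le_mono => a b ab; rewrite /raise.
have := raise_gt i b; rewrite /raise.
case: ifP => ub; case: ifP => ua; rewrite ?act_lt // => bx.
  rewrite -(act_lt (x i)) actVK; apply: lt_trans ab _.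
  by rewrite -(act_lt (x i)^-1) actK; apply: lt_trans bx;
    rewrite -(act_lt (x i)) actVK.
by apply: lt_trans bx; apply: lt_trans (upPn (negbT ub)); rewrite act_lt.
Qed.

Definition cyc i h := exists n, h = x i ^+ n \/ h = (x i ^+ n)^-1.

Lemma cyc_x i : cyc i (x i).
Proof. by exists 1%N; left. Qed.

Lemma cycV i h : cyc i h -> cyc i h^-1.
Proof. by case=> n [] ->; exists n; [right|left; rewrite invgK]. Qed.

Lemma cycM i h k : cyc i h -> cyc i k -> cyc i (h * k).
Proof.
have cyc_xM u : cyc i u -> cyc i (x i * u).
  case=> n [] ->; first by exists n.+1; left; rewrite expgS.
  case: n => [|n]; first by exists 1%N; left; rewrite invg1 mulg1.
  by exists n; right; rewrite expgSr invgM mulVKg.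
have cyc_VM u : cyc i u -> cyc i ((x i)^-1 * u).
  case=> n [] ->; last by exists n.+1; right; rewrite expgSr invgM.
  case: n => [|n]; first by exists 1%N; right; rewrite mulg1.
  by exists n; left; rewrite expgS mulKg.
case=> n [] -> ck.
  elim: n => [|n IH]; first by rewrite mul1g.
  by rewrite expgS -mulgA; apply: cyc_xM.
elim: n => [|n IH]; first by rewrite invg1 mul1g.
by rewrite expgSr invgM -mulgA; apply: cyc_VM.
Qed.

Definition cyc_orbit i a b := exists2 k, cyc i k & b = act k a.

Lemma cyc_orbit_raise i a b : cyc_orbit i a b <-> cyc_orbit i a (raise i b).
Proof.
have cyc_act k c : cyc i k -> cyc_orbit i a c -> cyc_orbit i a (act k c).
  by move=> ck [m cm ->]; exists (k * m); rewrite ?actM //; apply: cycM.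
rewrite /raise; case: ifP => _; split;
  try by apply: cyc_act; do ?apply: cycV; apply: cyc_x.
  by rewrite -{2}[b](actK (x i)); apply/cyc_act/cycV/cyc_x.
by rewrite -{2}[b](actVK (x i)); apply/cyc_act/cyc_x.
Qed.

(** [shift] swaps the coordinates and applies [raise i] to one of them, which preserves orbits of
    the powers of [x i]. *)
Lemma shift_orbit_cyc i a b p : shift_orbit (raise i) (a, b) p ->
  cyc_orbit i a p.1 \/ cyc_orbit i b p.1.
Proof.
pose P (p : T * T) := cyc_orbit i a p.1 /\ cyc_orbit i b p.2 \/
  cyc_orbit i b p.1 /\ cyc_orbit i a p.2.
move=> ob; suff: P p by case=> -[]; [left|right].
apply: (shift_orbit_ind (f := raise i) (p := (a, b))) ob => [q|].
  rewrite /P /=; have := cyc_orbit_raise i a q.1.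
  by have := cyc_orbit_raise i b q.1; tauto.
have cyc1 : cyc i 1 by exists 0%N; left.
by left; split; exists 1; rewrite ?act1.
Qed.

(** Turns a value [b] at [a] of a root y of [raise i] into that of a root of [x i]: where [x i]
    moves down, y squares to its inverse, and [x i] composed with y is the inverse of y. *)
Definition from_raise i a b := if up i a then b else act (x i) b.

Lemma from_raise_act i a b :
  exists2 k, cyc i k & from_raise i a b = act k b.
Proof.
rewrite /from_raise; case: ifP => _; last by exists (x i); first apply: cyc_x.
by exists 1; rewrite ?act1 //; exists 0%N; left.
Qed.

(* The pair [(h, [:: (i1, h1); ...; (im, hm)])] stands for the product
   [hm * y_im * ... * h1 * y_i1 * h]. *)
Fixpoint trace (r : I -> T -> T) h l b :=
  if l is (i, k) :: l' then trace r k l' (r i (act h b)) else act h b.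

(** [last] is the index of the root letter applied just before [h]; with [None], [h] is
    unrestricted, and so is the final coefficient. *)
Fixpoint reduced (last : option I) h l :=
  if l is (i, k) :: l' then ~ (last = Some i /\ cyc i h) /\ reduced (Some i) k l'
  else True.

(** [Q] represents the H-orbits met so far and [b] is the current point. On the orbit of [b] the
    germs are defined only at powers of the last root's generator, so a reduced product always meets
    an undefined value, which is sent to a new orbit. *)
Lemma generic_trace l : forall h last (Y : I -> T * T -> Prop) (Q : seq T) b,
    (forall i, root_germ (raise i) (Y i)) ->
    (forall i p, Y i p -> exists2 q, q \in Q & exists k, p.1 = act k q) ->
    b \in Q -> (forall i k c, Y i (act k b, c) -> last = Some i /\ cyc i k) ->
    reduced last h l ->
  exists Y' : I -> T * T -> Prop,
    [/\ forall i, root_germ (raise i) (Y' i), forall i p, Y i p -> Y' i p &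
      forall r, (forall i p, Y' i p -> r i p.1 = from_raise i p.1 p.2) ->
        forall q k, l <> [::] -> q \in Q -> trace r h l b <> act k q].
Proof.
elim: l => [|[i h'] l IH] h last Y Q b gY YQ bQ Yb red; first by exists Y.
case: red => not_last red'; set a := act h b.
have aY c : ~ Y i (a, c) by move/Yb.
have [u [v [uv gadj]]] :=
  germ_extend (@raiseK i) (@lowerK i) (@raise_lt i) (raise_gt i) (gY i) aY.
have [b0 ub0v fresh] := act_dense Q uv.
have [k0 ck0 bE] := from_raise_act i a b0.
(* [b0] is the value of the root of [raise i] and [b'] that of the root of [x i]; they share an
   H-orbit, so [b'] is fresh too. *)
set b' := from_raise i a b0 in bE.
have b0E : b0 = act k0^-1 b' by rewrite bE actK.
have fresh' q k : q \in Q -> b' <> act k q.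
  by move=> qQ E; apply: (fresh q (k0^-1 * k) qQ); rewrite actM -E -b0E.
pose Y1 j := if j == i then germ_adjoin (raise i) (Y i) (a, b0) else Y j.
have Y1P j p : Y1 j p -> Y j p \/ j = i /\ shift_orbit (raise i) (a, b0) p.
  by rewrite /Y1; case: eqVneq => [->|_]; [case; [left|right]|left].
have YY1 j p : Y j p -> Y1 j p.
  by rewrite /Y1; case: eqVneq => [->|_] //; left.
have Y1a : Y1 i (a, b0) by rewrite /Y1 eqxx; right; apply: shift_orbit_refl.
have [|||Y' [gY' Y1Y' Y'P]] :=
  IH h' (Some i) Y1 (b' :: Q) b' _ _ (mem_head _ _) _ red'.
- by move=> j; rewrite /Y1; case: eqVneq => [->|_ //]; apply: gadj.
- move=> j p /Y1P[/YQ[q qQ [k pE]]|[_ /shift_orbit_cyc[] [k _ ->]]].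
  + by exists q; [rewrite inE qQ orbT|exists k].
  + by exists b; [rewrite inE bQ orbT|exists (k * h); rewrite actM].
  + by exists b'; [apply: mem_head|exists (k / k0); rewrite actM -b0E].
(* By freshness only the [b0] half of the new orbit meets the H-orbit of [b']; freeness then
   identifies [k] as a power of [x i]. *)
- move=> j k c /Y1P[/YQ[q qQ [m /= E]]|[-> /shift_orbit_cyc[] [m cm /= E]]].
  + by case: (fresh' q (k^-1 * m) qQ); rewrite actM -E actK.
  + by case: (fresh' b (k^-1 * (m * h)) bQ); rewrite !actM -E actK.
  + split=> //; suff -> : k = m / k0 by apply: cycM => //; apply: cycV.
    rewrite -[RHS](mulgVK k) (@act_free (m / k0 / k) (act k b')) ?mul1g //.
    by rewrite -!actM mulgVK actM -b0E.
exists Y'; split=> // [j p /YY1/Y1Y' //|r rP q k _ qQ].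
rewrite /= -/a (rP _ _ (Y1Y' _ _ Y1a)) /= -/b'.
case: l Y'P {IH red'} => [_ /=|p l Y'P].
  by move=> E; apply: (fresh' q (h'^-1 * k) qQ); rewrite actM -E actK.
by apply: Y'P => //; rewrite inE qQ orbT.
Qed.

Lemma root_action_nontrivial h l b : reduced None h l ->
  exists r : I -> T -> T, [/\ forall i a, r i (r i a) = act (x i) a,
    forall i, {homo r i : a c / a < c} &
      (l = [::] -> h <> 1) -> trace r h l b <> b].
Proof.
move=> red.
have [|||Y [gY _ YP]] :=
  @generic_trace l h None (fun _ _ => False) [:: b] b _ _ (mem_head _ _) _ red => //.
  by move=> i; split=> //; exists [::].
have T_dense a c : a < c -> exists m, a < m < c.
  by move=> /(act_dense [::])[m amc _]; exists m.
have /choice[y yP] : forall i, exists y : T -> T, [/\ forall a, y (y a) = raise i a,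
    {homo y : a b / a < b}, forall a, a < y a < raise i a &
    forall p, Y i p -> y p.1 = p.2].
  move=> i; exact: (germ_total (@raiseK i) (@lowerK i) (@raise_lt i) (raise_gt i)
    T_dense e_onto (gY i)).
pose r i a := from_raise i a (y i a).
(* As [y i a] lies between [a] and [raise i a], both applications of the root use the same branch of
   [from_raise]. *)
have upy i a : up i (y i a) = up i a.
  have [_ _ /(_ a)/andP[] + + _] := yP i; rewrite /raise; case: ifP => ua ay ya.
    by apply: lt_trans ya _; rewrite act_lt.
  apply/negbTE; rewrite -leNgt ltW //; apply: lt_trans ay.
  by rewrite -(act_lt (x i)^-1) actK.
exists r; split.
- move=> i a; have [yy y_lt _ _] := yP i; rewrite {2}/r /from_raise.
  case: ifP => ua; rewrite /r /from_raise; first by rewrite upy ua yy /raise ua.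
  rewrite up_actx upy ua; congr (act _ _).
  have y_inj : injective (y i) by apply/inc_inj/le_mono.
  by apply: y_inj; rewrite yy /raise up_actx upy ua actK.
- move=> i a c ac; have [_ y_lt yb _] := yP i; rewrite /r /from_raise.
  have /andP[ay ya] := yb a; have /andP[cy yc] := yb c.
  case: ifP => ua; case: ifP => uc; rewrite ?act_lt; try exact: y_lt.
    move: ya; rewrite /raise ua => /lt_trans-> //; rewrite act_lt.
    exact: lt_trans ac cy.
  apply: lt_trans (lt_trans ac cy).
  by move: ya; rewrite /raise ua -(act_lt (x i)) actVK.
- case: l red YP => [_ _ /(_ erefl) h1 /act_free //|p l _ YP _].
  rewrite -[b in _ <> b](act1 b); apply: YP => //; last exact: mem_head.
  by move=> i q Yq; rewrite /r; have [_ _ _ ->] := yP i.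
Qed.

End GenericRoots.

(** * Lexicographic orders from countably many evaluations *)

(** Elements are compared at the first index, in [pickle] order, where [v] separates them; left
    multiplication keeps that index, since cancelling by the inverse shows that it preserves
    equalities as well. *)
Lemma lex_left_orderable (G : groupType) (d : Order.disp_t) (T : orderType d)
    (J : countType) (v : J -> G -> T) :
    (forall j g h k, v j h < v j k -> v j (g * h) < v j (g * k)) ->
    (forall g h, (forall j, v j g = v j h) -> g = h) ->
  left_orderable G.
Proof.
move=> v_lt v_inj.
have v_eq j g h k : v j h = v j k -> v j (g * h) = v j (g * k).
  move=> E; case: (ltgtP (v j (g * h)) (v j (g * k))) => // /(@v_lt _ g^-1);
    by rewrite !mulKg E ltxx.
pose lt g h := exists2 j, v j g < v j h &
  forall i, (pickle i < pickle j)%N -> v i g = v i h.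
have ltN g : ~ lt g g by case=> j; rewrite ltxx.
have ltT g h k : lt g h -> lt h k -> lt g k.
  case=> j gh jP [i hk iP]; case: (ltngtP (pickle i) (pickle j)) => ij.
  - exists i => [|m mi]; first by rewrite jP.
    by rewrite jP ?iP //; apply: ltn_trans mi ij.
  - exists j => [|m mj]; first by rewrite -iP.
    by rewrite jP ?iP //; apply: ltn_trans mj ij.
  - have E := pcan_inj pickleK ij; subst i; exists j; first exact: (lt_trans gh).
    by move=> m mj; rewrite jP // iP.
have lt_total g h : g <> h -> lt g h \/ lt h g.
  move=> gh; pose P m := `[< exists2 j, pickle j = m & v j g <> v j h >].
  have exP : exists m, P m.
    have [//|nex] := pselect (exists m, P m); case: gh; apply: v_inj => j.
    have [//|ne] := pselect (v j g = v j h); case: nex.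
    by exists (pickle j); apply/asboolP; exists j.
  case: (ex_minnP exP) => m /asboolP[j <- /eqP jgh] m_min.
  have eq_below i : (pickle i < pickle j)%N -> v i g = v i h.
    move=> ij; have [//|ne] := pselect (v i g = v i h).
    have /m_min : P (pickle i) by apply/asboolP; exists i.
    by rewrite leqNgt ij.
  case: (ltgtP (v j g) (v j h)) jgh => // jgh _; first by left; exists j.
  by right; exists j => // i /eq_below.
exists (fun g h => `[< g = h \/ lt g h >]); split.
- by move=> g; apply/asboolP; left.
- move=> g h /andP[/asboolP[// | gh] /asboolP[// | hg]].
  by case: (ltN g); apply: ltT hg.
- move=> h g k /asboolP[->|gh] /asboolP[<-|hk]; apply/asboolP;
    [by left|by right|by right|].
  by right; apply: ltT hk.
- move=> g h; have [->|/lt_total[gh|hg]] := pselect (g = h).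
  + by apply/orP; left; apply/asboolP; left.
  + by apply/orP; left; apply/asboolP; right.
  + by apply/orP; right; apply/asboolP; right.
- move=> g h k /asboolP[->|[j hk jP]]; apply/asboolP; first by left.
  by right; exists j => [|i /jP]; [apply: v_lt|apply: v_eq].
Qed.

(** * A free action of a countable left orderable group with dense orbits *)

Lemma rat_dense_avoid (L : seq rat) (q s : rat) :
  q < s -> exists2 t, q < t < s & t \notin L.
Proof.
elim: L s => [|c L IH] s qs; first by exists ((q + s) / 2%:R)%R; rewrite ?midf_lt.
have [qcs|ncs] := boolP (q < c < s).
  have /andP[qc cs] := qcs; have [t /andP[qt tc] tL] := IH c qc.
  exists t; first by rewrite qt (lt_trans tc).
  by rewrite inE negb_or tL (lt_eqF tc).
have [t qts tL] := IH s qs; exists t => //.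
by rewrite inE negb_or tL andbT; apply: contraNneq ncs => <-.
Qed.

Lemma total_order_model (G : groupType) (le : rel G) :
    reflexive le -> antisymmetric le -> transitive le -> total le ->
  exists (d : Order.disp_t) (O : orderType d) (f : G -> O) (g : O -> G),
    [/\ cancel f g, cancel g f & forall a b, (f a <= f b) = le a b].
Proof.
move=> le_refl le_anti le_trans le_total.
pose lt a b := (b != a) && le a b.
pose O := HB.pack_for (orderType (Order.Disp tt tt)) (Choice.sort G)
  (@Order.isOrder.Build (Order.Disp tt tt) G le lt
     (fun a b => if lt a b then a else b) (fun a b => if lt a b then b else a)
     (fun _ _ => erefl) (fun _ _ => erefl) (fun _ _ => erefl)
     le_anti le_trans le_total).
by exists _, O, id, id.
Qed.

(* Tensoring the regular action with [rat] makes every orbit dense. *)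
Lemma dense_free_action (G : groupType) (eG : nat -> G) :
    (forall g, exists m, eG m = g) -> left_orderable G ->
  exists (d : Order.disp_t) (T : orderType d) (act : G -> T -> T) (e : nat -> T),
    [/\ (forall a, act 1 a = a) /\ (forall h k a, act (h * k) a = act h (act k a)),
        forall h, {mono act h : a b / a < b},
        forall h a, act h a = a -> h = 1,
        forall (Q : seq T) a b, a < b ->
          exists2 c, a < c < b & forall q h, q \in Q -> c <> act h q
      & forall a, exists m, e m = a].
Proof.
move=> eG_onto [le [le_refl le_anti le_trans le_total le_mul]].
have [d [O [f [g [fK gK leE]]]]] :=
  total_order_model le_refl le_anti le_trans le_total.
have le_mulE h a b : le (h * a) (h * b) = le a b.
  by apply/idP/idP => [/(le_mul h^-1)|/le_mul//]; rewrite !mulKg.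
pose T : orderType _ := (O *l rat)%type.
pose pt (a : O) (q : rat) : T := (a, q).
have ltE a q b s : (pt a q < pt b s) = (a <= b) && ((b <= a) ==> (q < s)).
  exact: ltEprodlexi.
exists _, T, (fun h a => pt (f (h * g a.1)) a.2).
exists (fun m =>
  if unpickle m is Some (k, q) then pt (f (eG k)) q else pt (f 1) 0%R).
split.
- by split=> [[a q]|h k [a q]] /=; rewrite ?mul1g ?gK // fK mulgA.
- by move=> h [a q] [b s]; rewrite !ltE /= !leE !le_mulE -!leE !gK.
- move=> h [a q] [] /(congr1 g); rewrite fK.
  by move/(congr1 (fun z => z / g a)); rewrite mulgK mulgV.
- move=> Q [a q] [b s]; rewrite ltE => /andP[ab /implyP qs].
  (* The action fixes the rational coordinate, so a [t] different from the rational coordinates of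
     [Q] avoids all their orbits. *)
  have [t tP tQ] : exists2 t, pt a q < pt a t < pt b s &
      t \notin [seq p.2 | p <- Q].
    have [ba|/negbTE nba] := boolP (b <= a).
      have [t /andP[qt ts] tQ] := rat_dense_avoid [seq p.2 | p <- Q] (qs ba).
      by exists t => //; rewrite !ltE lexx ab qt ts !implybT.
    have [|t /andP[qt ts] tQ] := @rat_dense_avoid [seq p.2 | p <- Q] q (q + 1)%R.
      by rewrite ltrDl ltr01.
    by exists t => //; rewrite !ltE lexx ab qt nba.
  exists (pt a t) => // p h pQ [_ tE].
  by move/negP: tQ; apply; rewrite tE; apply: map_f.
- case=> a q; have [k kE] := eG_onto (g a).
  by exists (pickle (k, q)); rewrite pickleK kE gK.
Qed.

(** * Normal forms in the formal square root *)

Section FormalSqrt.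

Variables (n : nat) (R : relations 'I_n).

Local Notation H := (presented R).
Local Notation G := (formal_sqrt R).
Local Notation S := (sqrt_relations R).

Definition base_word (u : word 'I_n) : word ('I_n + 'I_n) :=
  [seq (inr a.1, a.2) | a <- u].

Lemma base_word_eq u v : pres_eq R u v -> pres_eq S (base_word u) (base_word v).
Proof.
rewrite /base_word; elim=> {u v} [u|u v _|u v w _ IHu _|p q x b|p q u v Ruv].
- exact: pres_eq_refl.
- exact: pres_eq_sym.
- exact: pres_eq_trans.
- by rewrite !map_cat /=; apply: (pres_eq_cancel S _ _ (inr x) b).
- by rewrite !map_cat; apply/pres_eq_rel/sqrt_base.
Qed.

Definition base (a : H) : G := \pi_(presented S) (base_word (repr a)).

Lemma base_pi u : base (\pi_(presented R) u) = \pi_(presented S) (base_word u).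
Proof. by apply/pi_presented/base_word_eq/pres_eq_repr. Qed.

Lemma baseM a b : base (a * b) = base a * base b.
Proof.
elim/quotW: a => u; elim/quotW: b => v; rewrite -[_ * _]pi_cat !base_pi.
by rewrite /base_word map_cat pi_cat.
Qed.

Lemma base1 : base 1 = 1.
Proof. by rewrite [1 in LHS](_ : _ = \pi_(presented R) [::]) // base_pi. Qed.

Lemma baseV a : base a^-1 = (base a)^-1.
Proof. by apply/esym/mulg1_eq; rewrite -baseM mulgV base1. Qed.

Definition xg (i : 'I_n) : H := gen R i.
Definition yg (i : 'I_n) : G := gen S (inl i).

Lemma base_xg i : base (xg i) = yg i * yg i.
Proof.
rewrite base_pi /yg /gen -[_ * _]pi_cat; apply/pi_presented.
exact: (pres_eq_rel [::] [::] (sqrt_square R i)).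
Qed.

(** The head of the list is the right end of the product, as in [trace], so right multiplication
    only affects the head. *)
Fixpoint nf (h : H) (l : seq ('I_n * H)) : G :=
  if l is (i, k) :: l' then nf k l' * yg i * base h else base h.

Lemma nf_base h l k : nf h l * base k = nf (h * k) l.
Proof. by case: l => [|[i m] l] /=; rewrite baseM ?mulgA. Qed.

Lemma yg_cyc_comm i h : cyc xg i h -> base h * yg i = yg i * base h.
Proof.
have comm m : base (xg i ^+ m) * yg i = yg i * base (xg i ^+ m).
  elim: m => [|m IH]; first by rewrite base1 mulg1 mul1g.
  by rewrite expgS baseM -mulgA IH base_xg !mulgA.
case=> m [] -> //.
apply: (mulgI (base (xg i ^+ m))); rewrite baseV mulVKg !mulgA comm.
by rewrite mulgK.
Qed.

(** If the last root letter is also y_i and [h] is a power of x_i, then y_i h y_i = x_i h is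
    absorbed into the next coefficient; otherwise y_i starts a new syllable. *)
Lemma nf_yg h l i : reduced xg None h l ->
  exists k m, reduced xg None k m /\ nf h l * yg i = nf k m.
Proof.
case: l => [|[j k] l] red.
  by exists 1, [:: (i, h)]; split=> /=; [split=> // -[]|rewrite base1 mulg1].
have [[<- ch]|not_cyc] := pselect (j = i /\ cyc xg i h).
  exists (k * (xg j * h)), l; split.
    by case: l red => [|[? ?] ?] //= [_ [_ ?]]; split=> // -[].
  by rewrite -nf_base baseM base_xg /= -!mulgA yg_cyc_comm // !mulgA.
exists 1, ((i, h) :: (j, k) :: l); split; last by rewrite /= base1 mulg1.
case: red => _ red; split; first by case.
by split=> // -[[ij] ch]; apply: not_cyc; rewrite ij.
Qed.

Lemma nf_exists (g : G) : exists h l, reduced xg None h l /\ g = nf h l.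
Proof.
elim/quotW: g => w; elim/last_ind: w => [|w z [h [l [red gE]]]].
  by exists 1, [::]; rewrite /= base1.
have red_any k m : reduced xg None k m -> forall k', reduced xg None k' m.
  by case: m => [|[? ?] ?] //= [_ ?] ?; split=> // -[].
rewrite -cats1 [X in exists h l, _ /\ X = _](pi_cat S w [:: z]) gE.
case: z => -[i|i] b; last first.
  exists (h * \pi_(presented R) [:: (i, b)]), l; split; first exact: red_any red _.
  by rewrite -nf_base base_pi.
have [k [m [redk kE]]] := nf_yg i red.
case: b; first by exists k, m.
(* The inverse of y_i is y_i times the inverse of x_i. *)
exists (k * (xg i)^-1), m; split; first exact: red_any redk _.
rewrite -nf_base -kE baseV base_xg invgM mulgA mulgK.
congr (_ * _); exact: (Defs.pi_inv S [:: (inl i, true)]).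
Qed.

(** * The action of the formal square root defined by a choice of roots *)

Section WordAction.

Variables (d : Order.disp_t) (T : orderType d) (act : H -> T -> T).
Hypotheses (act1 : forall a, act 1 a = a).
Hypotheses (actM : forall h k a, act (h * k) a = act h (act k a)).
Hypotheses (act_lt : forall h, {mono act h : a b / a < b}).
Variable r : 'I_n -> T -> T.
Hypotheses (r_sqrt : forall i a, r i (r i a) = act (xg i) a).
Hypothesis r_lt : forall i, {homo r i : a b / a < b}.

(** Since [r i] squares to x_i, its inverse is [r i] followed by the inverse of x_i. *)
Definition letter_act (z : ('I_n + 'I_n) * bool) (a : T) : T :=
  match z with
  | (inl i, true) => r i a
  | (inl i, false) => act (xg i)^-1 (r i a)
  | (inr i, true) => act (xg i) a
  | (inr i, false) => act (xg i)^-1 a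
  end.

Definition word_act (w : word ('I_n + 'I_n)) (a : T) : T := foldr letter_act a w.

Lemma word_act_base u a : word_act (base_word u) a = act (\pi_(presented R) u) a.
Proof.
elim: u a => [|[i b] u IH] a; first by rewrite [LHS](_ : _ = a) // -[LHS]act1.
rewrite /= IH -cat1s (pi_cat R [:: (i, b)] u) actM.
case: b => //=; congr (act _ _); exact/esym/(Defs.pi_inv R [:: (i, true)]).
Qed.

Lemma act_rC i a : act (xg i)^-1 (r i a) = r i (act (xg i)^-1 a).
Proof.
have rx b : act (xg i) (r i b) = r i (act (xg i) b) by rewrite -!r_sqrt.
by rewrite -[a in LHS](actVK act1 actM (xg i)) -rx (actK act1 actM).
Qed.

Lemma word_act_eq u v a : pres_eq S u v -> word_act u a = word_act v a.
Proof.
move=> uv; elim: uv a => {u v}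
  [//|u v _ IH a|u v w _ IHu _ IHv a|p q x b a|p q u v Suv a].
- by rewrite IH.
- by rewrite IHu.
- rewrite /word_act !foldr_cat /=; congr foldr.
  by case: x b => i [] /=; rewrite ?act_rC ?r_sqrt ?(actK act1 actM) ?(actVK act1 actM).
- rewrite /word_act !foldr_cat; congr foldr; move: (foldr _ _ q) => {q}a.
  case: Suv => {u v} [u v Ruv|i]; last by rewrite /= r_sqrt.
  rewrite -!/(word_act _ _) !word_act_base; congr (act _ _).
  by apply/pi_presented; have := pres_eq_rel [::] [::] Ruv; rewrite !cats0.
Qed.

Definition sqrt_act (g : G) (a : T) : T := word_act (repr g) a.

Lemma sqrt_act_pi w a : sqrt_act (\pi_(presented S) w) a = word_act w a.
Proof. exact/word_act_eq/pres_eq_repr. Qed.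

Lemma sqrt_actM g h a : sqrt_act (g * h) a = sqrt_act g (sqrt_act h a).
Proof.
elim/quotW: g => u; elim/quotW: h => v; rewrite -[_ * _]pi_cat !sqrt_act_pi.
by rewrite /word_act foldr_cat.
Qed.

Lemma sqrt_act_lt g a b : a < b -> sqrt_act g a < sqrt_act g b.
Proof.
rewrite /sqrt_act; elim: (repr g) => //= -[[i|i] []] w IH /IH ab //=;
  by rewrite ?act_lt //; apply: r_lt.
Qed.

Lemma sqrt_act_nf h l a : sqrt_act (nf h l) a = trace act r h l a.
Proof.
have act_base k b : sqrt_act (base k) b = act k b.
  by elim/quotW: k => u; rewrite base_pi sqrt_act_pi word_act_base.
elim: l h a => [|[i k] l IH] h a //=.
by rewrite !sqrt_actM act_base IH /yg /gen sqrt_act_pi.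
Qed.

End WordAction.

End FormalSqrt.

Theorem theorem4p3 (n : nat) (R : relations 'I_n) :
  left_orderable (presented R) ->
  reduced_presentation R ->
  left_orderable (formal_sqrt R).
Proof.
move=> loH redR.
pose eH m := if unpickle m is Some u then \pi_(presented R) u else 1.
have eH_onto g : exists m, eH m = g.
  by exists (pickle (repr g)); rewrite /eH pickleK reprK.
have [d [T [act [e [[act1 actM] act_lt act_free act_dense e_onto]]]]] :=
  dense_free_action eH_onto loH.
(* Each word gets its own roots, under which it moves the base point [e 0] if it is nontrivial in
   G. *)
have /choice[r rP] : forall w : word ('I_n + 'I_n), exists r : 'I_n -> T -> T,
    [/\ forall i a, r i (r i a) = act (xg R i) a,
      forall i, {homo r i : a b / a < b} &
      \pi_(presented (sqrt_relations R)) w <> 1 -> word_act act r w (e 0%N) <> e 0%N].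
  move=> w; have [h [l [red wE]]] :=
    nf_exists (\pi_(presented (sqrt_relations R)) w : formal_sqrt R).
  have [r [r_sqrt r_lt rP]] := root_action_nontrivial act1 actM act_lt
    act_free act_dense e_onto redR (e 0%N) red.
  exists r; split=> // w1.
  rewrite -(sqrt_act_pi act1 actM r_sqrt) wE (sqrt_act_nf act1 actM r_sqrt).
  by apply: rP => l0 h1; apply: w1; rewrite wE l0 h1 /= base1.
apply: (@lex_left_orderable _ _ T (word ('I_n + 'I_n))
  (fun w g => sqrt_act act (r w) g (e 0%N))) => [w g h k|g h gh].
  have [r_sqrt r_lt _] := rP w.
  by rewrite !(sqrt_actM act1 actM r_sqrt); apply: sqrt_act_lt.
have [//|gh'] := pselect (g = h).
(* The action attached to a word for [g^-1 * h] separates [g] from [h] at the base point. *)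
have [r_sqrt r_lt] := rP (repr (g^-1 * h)); rewrite reprK.
case; first by move/mulg1_eq; rewrite invgK.
have act_inj := inc_inj (le_mono (sqrt_act_lt act_lt r_lt g)).
apply: act_inj; rewrite -[word_act _ _ _ _]/(sqrt_act act _ (g^-1 * h) _).
by rewrite -(sqrt_actM act1 actM r_sqrt) mulVKg gh.
Qed.
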